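(* For every integer $k\ge 1$, $b_k$ is the number whose base 5 digits are the base 3 digits of $2k-1$ (that is, if $2k-1=\sum_{i\ge 1} d_i 3^{i-1}$ with $d_i\in\{0,1,2\}$, then $b_k=\sum_{i\ge 1} d_i 5^{i-1}$); i.e. $b_k=a_{2k-1}$. Furthermore, for every integer $n\ge 1$, $g_n \bmod 10$ can only take on the values $1$, $5$ or $9$, as follows: if $n\notin\{b_k\}$ then $g_n\bmod 10=5$; if $n\in\{b_k\}$ then $u_n \bmod 4\in\{1,3\}$ and $$g_n \bmod 10=\begin{cases}1 & \text{if } u_n \bmod 4=1,\\ 9 & \text{if } u_n \bmod 4=3.\end{cases}$$
   Context: For a positive integer $n$, $g_n=\sum_{i=1}^n\binom{n}{i}\binom{2n-2i}{n-i}$. $\{a_k\}_{k\ge 1}$ denotes the set of all positive integers $n$, listed in increasing order $a_1<a_2<\cdots$, for which $\binom{2n}{n}$ is not divisible by 5. $\{b_k\}_{k\ge 1}$ denotes the set of all positive integers $n$, listed in increasing order $b_1<b_2<\cdots$, for which $g_n$ is not divisible by 5. $u_n$ denotes the number of digits equal to 1 in the base 5 representation of $n$. $x \bmod m$ denotes the remainder in $\{0,\dots,m-1\}$ of $x$ on division by $m$. *)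

(* Defs.v *)
From mathcomp Require Import all_boot.

Set Implicit Arguments.
Unset Strict Implicit.
Unset Printing Implicit Defensive.

Definition g (n : nat) : nat :=
  \sum_(1 <= i < n.+1) 'C(n, i) * 'C(2 * n - 2 * i, n - i).

(* The least significant digit has position 0. *)
Definition digit (base n i : nat) : nat := (n %/ base ^ i) %% base.

(* Positions i >= n need not be inspected: n < 5 ^ n, so those digits are 0. *)
Definition u (n : nat) : nat := count (fun i => digit 5 n i == 1) (iota 0 n).

Definition unbounded (P : pred nat) : Prop :=
  forall m, exists n, (m < n) && P n.

(* For k >= 1, enumeration HP k is the k-th positive integer satisfying P, in
   increasing order; the value 0 at k = 0 only starts the recursion. *)
Fixpoint enumeration (P : pred nat) (HP : unbounded P) (k : nat) : nat :=
  if k is k'.+1 then ex_minn (HP (enumeration HP k')) else 0.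

Definition in_a : pred nat := fun n => ~~ (5 %| 'C(2 * n, n)).
Definition in_b : pred nat := fun n => ~~ (5 %| g n).

Lemma dvd5_bin_pow (j i : nat) : 0 < i < 5 ^ j -> 5 %| 'C(5 ^ j, i).
Proof.
case: i => // i /andP[_ lt_i]; apply: contraLR lt_i => ndvd.
have co : coprime (5 ^ j) 'C(5 ^ j, i.+1).
  by rewrite coprimeXl // prime_coprime.
rewrite -leqNgt dvdn_leq // -(Gauss_dvdl _ co).
by rewrite -mul_bin_diag dvdn_mulr.
Qed.

Lemma in_a_pow (j : nat) : in_a (5 ^ j).
Proof.
have n_gt0 : 0 < 5 ^ j by rewrite expn_gt0.
have dv := @dvd5_bin_pow j; move: (5 ^ j) n_gt0 dv => [//|n] _ dv.
rewrite /in_a mul2n -addnn -binomial.Vandermonde big_ord_recl big_ord_recr /=.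
rewrite /bump /= add1n bin0 subn0 subnn binn bin0 !muln1 addnCA dvdn_addr //.
by apply: dvdn_sum => i _; rewrite dvdn_mulr // dv //= add1n ltnS ltn_ord.
Qed.

Lemma in_b_pow (j : nat) : in_b (5 ^ j).
Proof.
have n_gt0 : 0 < 5 ^ j by rewrite expn_gt0.
have dv := @dvd5_bin_pow j; move: (5 ^ j) n_gt0 dv => [//|n] _ dv.
rewrite /in_b /g big_nat_recr //= subnn binn subnn bin0 muln1 dvdn_addr //.
rewrite big_nat_cond; apply: dvdn_sum => i; rewrite andbT => lt_i.
by rewrite dvdn_mulr // dv.
Qed.

Lemma unbounded_a : unbounded in_a.
Proof. by move=> m; exists (5 ^ m); rewrite ltn_expl // in_a_pow. Qed.

Lemma unbounded_b : unbounded in_b.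
Proof. by move=> m; exists (5 ^ m); rewrite ltn_expl // in_b_pow. Qed.

Definition a : nat -> nat := enumeration unbounded_a.
Definition b : nat -> nat := enumeration unbounded_b.

(* Main.v *)
Require Import Defs.
From mathcomp Require Import all_boot.
From mathcomp Require Import zify.

(** Adding the missing term [i = 0] to [g n] gives
    [g n + central n = transform n], where [central n = C(2n, n)] and
    [transform n], the sum of the [C(n, j) C(2j, j)], is its binomial transform.
    Modulo a prime [p], Lucas' congruence makes [f = central] and
    [f = transform] multiplicative along the base [p] digits:
    [f (p m + r) = f m * f r] for [r < p]
    ([central_lucas], [transform_lucas]).  For [p = 5] the values at the digits
    0, 1, 2, 3, 4 are 1, 2, 1, 0, 0 for [central] and 1, 3, 1, 0, 0 for
    [transform].  Hence both vanish modulo 5 as soon as a digit of [n] is at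
    least 3, and otherwise they are [2 ^ u n] and [3 ^ u n].  In the latter case
    [g n = 3 ^ u n - 2 ^ u n] modulo 5, which is 0 for even [u n], and 1 or 4 for
    [u n] congruent to 1 or 3 modulo 4 ([g_rebase]).  Since [g n] is odd, its
    residue modulo 5 determines its last decimal digit.

    The numbers with digits 0, 1, 2 in base 5 are the values of the strictly
    increasing map [rebase], which reads in base 5 the ternary digits of its
    argument; so [a] enumerates the values of [rebase].  As 3 is odd, a number
    has the parity of the sum of its ternary digits, hence that of its number of
    ternary digits 1: [u (rebase m)] is odd exactly when [m] is
    ([odd_u_rebase]).  Thus [b] enumerates the values of [rebase] at odd
    arguments. *)

(** * Digits *)

Lemma digit0 b n : digit b n 0 = n %% b.
Proof. by rewrite /digit expn0 divn1. Qed.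

Lemma digitS b n i : digit b n i.+1 = digit b (n %/ b) i.
Proof. by rewrite /digit expnS divnMA. Qed.

Lemma digit_small b n i : 1 < b -> n <= i -> digit b n i = 0.
Proof.
move=> b_gt1 le_ni; rewrite /digit divn_small ?mod0n //.
exact: leq_ltn_trans le_ni (ltn_expl _ _).
Qed.

Lemma divnMDr b q r : r < b -> (b * q + r) %/ b = q.
Proof.
by move=> lt_rb; rewrite mulnC divnMDl ?divn_small ?addn0 //; case: b lt_rb.
Qed.

Lemma modnMDr b q r : r < b -> (b * q + r) %% b = r.
Proof. by move=> lt_rb; rewrite mulnC modnMDl modn_small. Qed.

Lemma base_ind b (P : nat -> Prop) : 1 < b -> P 0 ->
  (forall q r, r < b -> P q -> P (b * q + r)) -> forall n, P n.
Proof.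
move=> b_gt1 P0 PS; elim/ltn_ind=> n IHn.
have [->//|n_gt0] := posnP n.
rewrite (divn_eq n b) mulnC; apply: PS; first by rewrite ltn_mod ltnW.
by apply: IHn; rewrite ltn_Pdiv.
Qed.

(** The bound on the positions in [u] is [n] itself; positions at or above the
    argument only see the digit 0, so any larger bound gives the same count. *)
Lemma u_widen n N : n <= N -> u n = count (fun i => digit 5 n i == 1) (iota 0 N).
Proof.
move=> le_nN; rewrite -(subnKC le_nN) iotaD count_cat add0n /u.
rewrite [X in _ + X](_ : _ = 0) ?addn0 //; apply/eqP.
rewrite -leqn0 leqNgt -has_count; apply/hasPn => i.
by rewrite mem_iota => /andP[le_ni _]; rewrite digit_small.
Qed.

Lemma u_rec q r : r < 5 -> u (5 * q + r) = (r == 1) + u q.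
Proof.
move=> lt_r5; rewrite (@u_widen _ (5 * q + r).+1) //=.
rewrite digit0 modnMDr // (iotaDl 1 0) count_map; congr (_ + _).
rewrite (@u_widen q (5 * q + r)); last by lia.
by apply: eq_count => i /=; rewrite add1n digitS divnMDr.
Qed.

(** * Reading ternary digits in base 5 *)

Definition rebase (m : nat) : nat := \sum_(i < m) digit 3 m i * 5 ^ i.

Lemma rebase_widen m N : m <= N ->
  rebase m = \sum_(i < N) digit 3 m i * 5 ^ i.
Proof.
move=> le_mN; rewrite /rebase -!(big_mkord xpredT (fun i => digit 3 m i * 5 ^ i)).
rewrite (@big_cat_nat _ _ _ m 0 N) //= [X in _ + X]big_nat_cond.
rewrite [X in _ + X]big1 ?addn0 // => i /andP[/andP[le_mi _] _].
by rewrite digit_small.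
Qed.

Lemma rebase0 : rebase 0 = 0.
Proof. by rewrite /rebase big_ord0. Qed.

Lemma rebase_rec q r : r < 3 -> rebase (3 * q + r) = 5 * rebase q + r.
Proof.
move=> lt_r3; rewrite (@rebase_widen _ (3 * q + r).+1) // big_ord_recl.
rewrite digit0 modnMDr // expn0 muln1 addnC; congr (_ + _).
rewrite (@rebase_widen q (3 * q + r)); last by lia.
rewrite big_distrr; apply: eq_bigr => i _ /=.
by rewrite digitS divnMDr // expnS mulnCA.
Qed.

Lemma rebase_div m : rebase m = 5 * rebase (m %/ 3) + m %% 3.
Proof. by rewrite {1}(divn_eq m 3) mulnC rebase_rec ?ltn_mod. Qed.

Lemma digit_rebase m i : digit 5 (rebase m) i = digit 3 m i.
Proof.
have lt_m5 k : k %% 3 < 5 by apply: ltn_trans (ltn_pmod _ _) _.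
elim: i m => [|i IHi] m; first by rewrite !digit0 rebase_div modnMDr.
by rewrite !digitS [rebase m]rebase_div divnMDr.
Qed.

Lemma sum_nth_cons b x (d : seq nat) :
  \sum_(0 <= i < size (x :: d)) nth 0 (x :: d) i * b ^ i =
  b * (\sum_(0 <= i < size d) nth 0 d i * b ^ i) + x.
Proof.
rewrite big_nat_recl //= expn0 muln1 addnC; congr (_ + _).
by rewrite big_distrr /=; apply: eq_bigr => i _; rewrite expnS mulnCA.
Qed.

Lemma rebase_seq (d : seq nat) : all (fun x => x < 3) d ->
  rebase (\sum_(0 <= i < size d) nth 0 d i * 3 ^ i) =
  \sum_(0 <= i < size d) nth 0 d i * 5 ^ i.
Proof.
elim: d => [|x d IHd]; first by rewrite !big_nil rebase0.
by move=> /andP[lt_x3 /IHd IH]; rewrite !sum_nth_cons rebase_rec // IH.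
Qed.

Lemma ltn_rebase m n : m < n -> rebase m < rebase n.
Proof.
elim/ltn_ind: n m => n IHn m lt_mn; rewrite (rebase_div m) (rebase_div n).
have [lt_q | le_q] := ltnP (m %/ 3) (n %/ 3).
  have := IHn (n %/ 3) _ _ lt_q; rewrite ltn_Pdiv //; last by lia.
  move=> /(_ isT); have : m %% 3 < 3 by rewrite ltn_mod.
  lia.
have -> : m %/ 3 = n %/ 3 by lia.
lia.
Qed.

(** Adding a last ternary digit [r] changes the parity of [m] by that of [r],
    because 3 is odd, and among 0, 1, 2 only 1 is odd. *)
Lemma odd_u_rebase m : odd (u (rebase m)) = odd m.
Proof.
elim/(@base_ind 3): m => // [|q r lt_r3 IHq]; first by rewrite rebase0.
rewrite rebase_rec // u_rec; last by apply: ltn_trans lt_r3 _.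
rewrite oddD [RHS]oddD oddM IHq addbC.
by case: r lt_r3 => [|[|[|]]].
Qed.

(** * Lucas' congruence *)

Lemma addn_modr d m n : d %| n -> m + n = m %[mod d].
Proof. by move=> /eqP d_n; rewrite -modnDmr d_n addn0. Qed.

(** In Vandermonde's convolution for [C(p + n, p + j)], only the two extreme
    coefficients of row [p] survive modulo [p]. *)
Lemma bin_addp p n j : prime p ->
  'C(p + n, p + j) = 'C(n, p + j) + 'C(n, j) %[mod p].
Proof.
move=> p_pr; rewrite -binomial.Vandermonde.
have p_gt0 := prime_gt0 p_pr.
rewrite (bigD1 (Ordinal (ltn0Sn (p + j)))) //=.
have lt_p : p < (p + j).+1 by rewrite ltnS leq_addr.
rewrite (bigD1 (Ordinal lt_p)) /=; last by rewrite -val_eqE /= -lt0n.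
rewrite bin0 subn0 binn addKn !mul1n addnA; apply: addn_modr.
apply: dvdn_sum => i; rewrite -!val_eqE /= => /andP[i_neq0 i_neqp].
apply: dvdn_mulr; case: (ltngtP i p) i_neqp => // [lt_ip | lt_pi] _.
  by rewrite prime_dvd_bin // lt0n i_neq0.
by rewrite bin_small.
Qed.

Lemma bin_addp_small p n j : prime p -> j < p ->
  'C(p + n, j) = 'C(n, j) %[mod p].
Proof.
move=> p_pr lt_jp; rewrite -binomial.Vandermonde big_ord_recl /=.
rewrite bin0 subn0 mul1n; apply: addn_modr; apply: dvdn_sum => i _; apply: dvdn_mulr; rewrite prime_dvd_bin //=.
by apply: leq_ltn_trans lt_jp; rewrite /bump /= add1n.
Qed.

(** Removing one [p] at a time from the upper index turns Pascal's rule for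
    [C(m, q)] into the rule [bin_addp]. *)
Lemma lucas p m r q s : prime p -> r < p -> s < p ->
  'C(p * m + r, p * q + s) = 'C(m, q) * 'C(r, s) %[mod p].
Proof.
move=> p_pr lt_rp lt_sp; elim: m q => [|m IHm] [|q].
- by rewrite !muln0 bin0 mul1n.
- rewrite muln0 bin0n mul0n bin_small // mulnS add0n.
  by apply: leq_trans lt_rp _; rewrite -addnA leq_addr.
- rewrite mulnS muln0 add0n -addnA bin_addp_small //.
  by have:= IHm 0; rewrite muln0 !bin0.
- by rewrite !mulnS -!addnA bin_addp // !addnA -mulnS -modnDm !IHm modnDm binS mulnDl.
Qed.

(** * Central binomial coefficients and their binomial transform *)

Definition central (n : nat) : nat := 'C(2 * n, n).

Definition transform (n : nat) : nat := \sum_(j < n.+1) 'C(n, j) * central j.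

(** When [2 r >= p], doubling [p m + r] produces a carry: the last digit
    [2 r - p] is smaller than [r], so both sides vanish. *)
Lemma central_lucas p m r : prime p -> r < p ->
  central (p * m + r) = central m * central r %[mod p].
Proof.
move=> p_pr lt_rp; rewrite /central.
have [lt_2r | le_p2r] := ltnP (2 * r) p.
  by rewrite mulnDr mulnCA lucas.
have lt_sp : 2 * r - p < p by lia.
have lt_sr : 2 * r - p < r by lia.
have vanish k : 'C(2 * (p * k + r), p * k + r) = 0 %[mod p].
  have -> : 2 * (p * k + r) = p * (2 * k + 1) + (2 * r - p) by nia.
  by rewrite lucas // [X in _ * X]bin_small // muln0.
have := vanish 0; rewrite muln0 add0n => vanish0.
by rewrite vanish -[RHS]modnMmr vanish0 mod0n muln0 mod0n.
Qed.

Lemma transform_widen n N : n < N ->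
  transform n = \sum_(j < N) 'C(n, j) * central j.
Proof.
move=> lt_nN; rewrite /transform -!(big_mkord xpredT (fun j => 'C(n, j) * central j)).
rewrite (@big_cat_nat _ _ _ n.+1 0 N) //= [X in _ + X]big_nat_cond.
rewrite [X in _ + X]big1 ?addn0 // => i /andP[/andP[lt_ni _] _].
by rewrite bin_small.
Qed.

Lemma sum_mul_digits p m (F : nat -> nat) :
  \sum_(j < p * m) F j = \sum_(q < m) \sum_(s < p) F (p * q + s).
Proof.
elim: m => [|m IHm]; first by rewrite muln0 !big_ord0.
rewrite big_ord_recr /= -IHm mulnS addnC big_split_ord.
by congr (_ + _); apply: eq_bigr.
Qed.

Lemma eqn_mod_sum p n (F G : nat -> nat) :
  (forall i, i < n -> F i = G i %[mod p]) ->
  \sum_(i < n) F i = \sum_(i < n) G i %[mod p].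
Proof.
elim: n => [|n IHn] FG; first by rewrite !big_ord0.
rewrite !big_ord_recr /= -modnDm IHn => [|i lt_in]; last exact/FG/ltnW.
by rewrite FG // modnDm.
Qed.

(** Writing the summation index as [p q + s], both factors of the summand split
    as a function of [q] times a function of [s]. *)
Lemma transform_lucas p m r : prime p -> r < p ->
  transform (p * m + r) = transform m * transform r %[mod p].
Proof.
move=> p_pr lt_rp.
rewrite (@transform_widen _ (p * m.+1)); last by rewrite mulnS; lia.
pose F j := 'C(p * m + r, j) * central j.
pose G q s := 'C(m, q) * central q * ('C(r, s) * central s).
rewrite (sum_mul_digits _ _ F) (@transform_widen r p) //.
rewrite [transform m]/transform big_distrl /=.
under [in RHS]eq_bigr do rewrite big_distrr /=.
apply: (@eqn_mod_sum _ _ (fun q => \sum_(s < p) F (p * q + s))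
          (fun q => \sum_(s < p) G q s)) => q _.
apply: (@eqn_mod_sum _ _ (fun s => F (p * q + s)) (G q)) => s lt_sp.
by rewrite /F /G -modnMm lucas // central_lucas // modnMm mulnACA.
Qed.

Lemma g_add_central n : g n + central n = transform n.
Proof.
rewrite /transform (reindex_inj rev_ord_inj) /= big_ord_recl /= addnC.
rewrite subSS subn0 binn mul1n; congr (_ + _).
rewrite /g big_add1 /= big_mkord; apply: eq_bigr => i _.
by rewrite /bump /= add1n subSS bin_sub // /central mulnBr.
Qed.

Lemma odd_central n : 0 < n -> odd (central n) = false.
Proof.
case: n => // n _; rewrite /central mul2n doubleS binS.
have -> : 'C(n.*2.+1, n) = 'C(n.*2.+1, n.+1).
  by rewrite -[RHS]bin_sub; [congr 'C(_, _); lia | lia].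
by rewrite addnn odd_double.
Qed.

(** [C(2j, j)] is even for [j > 0], so the only odd term of [transform n] is the
    one at [j = 0]. *)
Lemma odd_g n : 0 < n -> odd (g n).
Proof.
move=> n_gt0; have:= congr1 odd (g_add_central n).
rewrite oddD odd_central // addbF => ->; rewrite /transform big_ord_recl oddD.
rewrite bin0 [X in _ (+) X](_ : _ = false) //; apply: negbTE; rewrite -dvdn2.
by apply: dvdn_sum => j _; rewrite dvdn_mull // dvdn2 odd_central.
Qed.

(** * Residues modulo 5 *)

(** With multiplicativity, each base 5 digit 1 contributes a factor [x] and the
    digits 0 and 2 contribute nothing. *)
Lemma rebase_multiplicative (f : nat -> nat) x m :
  (forall q r, r < 5 -> f (5 * q + r) = f q * f r %[mod 5]) ->
  f 0 = 1 %[mod 5] -> f 1 = x %[mod 5] -> f 2 = 1 %[mod 5] ->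
  f (rebase m) = x ^ u (rebase m) %[mod 5].
Proof.
move=> fM f0 f1 f2; elim/(@base_ind 3): m => // [|q r lt_r3 IHq].
  by rewrite rebase0 f0.
have lt_r5 : r < 5 by apply: ltn_trans lt_r3 _.
rewrite rebase_rec // u_rec // fM // -modnMm {}IHq expnD [in RHS]mulnC -[RHS]modnMm.
by congr (_ * _ %% _); case: r lt_r3 {lt_r5} => [|[|[|]]] //= _; rewrite ?f0 ?f1 ?f2.
Qed.

(** A number outside the range of [rebase] has a digit 3 or 4, which contributes
    a factor divisible by 5. *)
Lemma rebase_or_vanish (f : nat -> nat) n :
  (forall q r, r < 5 -> f (5 * q + r) = f q * f r %[mod 5]) ->
  5 %| f 3 -> 5 %| f 4 -> (exists m, n = rebase m) \/ 5 %| f n.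
Proof.
move=> fM f3 f4; elim/(@base_ind 5): n => // [|q r lt_r5 IHq].
  by left; exists 0; rewrite rebase0.
rewrite /dvdn fM // -/(dvdn _ _).
case: IHq => [[m ->]|f_q]; last by right; rewrite dvdn_mulr.
have [lt_r3|le_3r] := ltnP r 3.
  by left; exists (3 * m + r); rewrite rebase_rec.
by right; rewrite dvdn_mull //; case: r lt_r5 le_3r => [|[|[|[|[|]]]]].
Qed.

Lemma central_rebase m : central (rebase m) = 2 ^ u (rebase m) %[mod 5].
Proof.
by apply: (@rebase_multiplicative central) => // q r; apply: central_lucas.
Qed.

Lemma transform_rebase m : transform (rebase m) = 3 ^ u (rebase m) %[mod 5].
Proof.
apply: (@rebase_multiplicative transform) => [q r|||].
  exact: transform_lucas.
all: by rewrite /transform !big_ord_recl big_ord0.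
Qed.

Lemma central_vanish n : (exists m, n = rebase m) \/ 5 %| central n.
Proof. by apply: rebase_or_vanish => // q r; apply: central_lucas. Qed.

Lemma transform_vanish n : (exists m, n = rebase m) \/ 5 %| transform n.
Proof.
apply: rebase_or_vanish => [q r||]; first exact: transform_lucas.
all: by rewrite /transform !big_ord_recl big_ord0.
Qed.

Lemma expn_mod4 x k : x ^ 4 = 1 %[mod 5] -> x ^ k = x ^ (k %% 4) %[mod 5].
Proof.
move=> x4.
have -> : x ^ k = (x ^ 4) ^ (k %/ 4) * x ^ (k %% 4).
  by rewrite -expnM -expnD mulnC -divn_eq.
by rewrite -modnMml -modnXm x4 modnXm exp1n modnMml mul1n.
Qed.

(** The list holds [3 ^ s - 2 ^ s] modulo 5 for [s = 0, 1, 2, 3]; by Fermat's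
    little theorem only the exponent modulo 4 matters. *)
Lemma g_rebase m :
  g (rebase m) %% 5 = nth 0 [:: 0; 1; 0; 4] (u (rebase m) %% 4).
Proof.
set n := rebase m; have := congr1 (modn^~ 5) (g_add_central n).
rewrite transform_rebase -modnDmr central_rebase -/n.
rewrite (@expn_mod4 3) // (@expn_mod4 2) //.
have: u n %% 4 < 4 by rewrite ltn_mod.
by case: (u n %% 4) => [|[|[|[|]]]] //= _; rewrite !(expnS, expn0); lia.
Qed.

Lemma in_aP n : in_a n <-> exists m, n = rebase m.
Proof.
split=> [|[m ->]]; first by case: (central_vanish n) => // dvd; rewrite /in_a dvd.
rewrite /in_a /dvdn central_rebase -/(dvdn _ _).
by rewrite Euclid_dvdX.
Qed.

Lemma in_b_rebase m : in_b (rebase m) = odd m.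
Proof.
rewrite -odd_u_rebase /in_b /dvdn g_rebase -[odd (u _)](@odd_mod _ 4) //.
have: u (rebase m) %% 4 < 4 by rewrite ltn_mod.
by case: (u _ %% 4) => [|[|[|[|]]]].
Qed.

Lemma in_bP n : in_b n <-> exists2 m, odd m & n = rebase m.
Proof.
split=> [b_n|[m odd_m ->]]; last by rewrite in_b_rebase.
suff [m def_n]: exists m, n = rebase m.
  by exists m; rewrite // -in_b_rebase -def_n.
case: (central_vanish n) => // dvd_c; case: (transform_vanish n) => // dvd_t.
by move: dvd_t b_n; rewrite -g_add_central dvdn_addl // /in_b => ->.
Qed.

(** * The enumerations *)

Lemma enumeration_eq (P : pred nat) (HP : unbounded P) (f : nat -> nat) :
  f 0 = 0 -> {homo f : i j / i < j} ->
  (forall n, 0 < n -> P n <-> exists k, n = f k.+1) ->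
  forall k, enumeration HP k = f k.
Proof.
move=> f0 f_homo fP; have f_mono := leqW_mono (leq_mono f_homo).
elim=> [|k IHk] //=; rewrite IHk.
case: ex_minnP => n /andP[lt_fk_n Pn] n_min; apply/eqP.
have fS_gt0 : 0 < f k.+1 by rewrite -f0 f_mono.
rewrite eqn_leq n_min; last by rewrite f_mono ltnSn; apply/fP => //; exists k.
have /fP[|j def_n] := Pn; first exact: leq_ltn_trans lt_fk_n.
by rewrite def_n leq_mono //; move: lt_fk_n; rewrite def_n f_mono.
Qed.

Lemma a_rebase k : a k = rebase k.
Proof.
apply: enumeration_eq k => [||n n_gt0]; first exact: rebase0.
  by move=> i j; apply: ltn_rebase.
split=> [/in_aP[[|m] def_n]|[m ->]]; last by apply/in_aP; exists m.+1.
  by rewrite def_n rebase0 in n_gt0.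
by exists m.
Qed.

(** Here [2 * k - 1] is truncated to 0 at [k = 0], which gives the starting
    value 0 of the recursion. *)
Lemma b_rebase k : b k = rebase (2 * k - 1).
Proof.
apply: (@enumeration_eq _ _ (fun k => rebase (2 * k - 1))) => [||n n_gt0].
- exact: rebase0.
- by move=> i j lt_ij; apply: ltn_rebase; lia.
split=> [/in_bP[m odd_m ->]|[m ->]]; last first.
  by rewrite in_b_rebase; lia.
by exists m./2; congr rebase; lia.
Qed.

Lemma in_b_enumerated n : in_b n <-> exists k, 1 <= k /\ n = b k.
Proof.
split=> [/in_bP[m odd_m ->]|[k [k_gt0 ->]]].
  by exists m./2.+1; rewrite b_rebase; split=> //; congr rebase; lia.
by rewrite b_rebase in_b_rebase; lia.
Qed.

Theorem theorem2 :
  (forall k : nat, 1 <= k ->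
     [/\ forall i : nat, digit 5 (b k) i = digit 3 (2 * k - 1) i,
         forall d : seq nat, all (fun x => x < 3) d ->
           2 * k - 1 = \sum_(0 <= i < size d) nth 0 d i * 3 ^ i ->
           b k = \sum_(0 <= i < size d) nth 0 d i * 5 ^ i
       & b k = a (2 * k - 1)])
  /\
  (forall n : nat, 1 <= n ->
     [/\ g n %% 10 \in [:: 1; 5; 9],
         ~ (exists k : nat, 1 <= k /\ n = b k) -> g n %% 10 = 5
       & (exists k : nat, 1 <= k /\ n = b k) ->
           [/\ u n %% 4 \in [:: 1; 3],
               u n %% 4 = 1 -> g n %% 10 = 1
             & u n %% 4 = 3 -> g n %% 10 = 9]]).
Proof.
split=> [k k_gt0|n n_gt0].
  rewrite b_rebase a_rebase; split=> // [i|d d_lt3 ->]; first exact: digit_rebase.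
  exact: rebase_seq.
have g_odd := odd_g _ n_gt0.
have not_b : ~~ in_b n -> g n %% 10 = 5.
  by rewrite /in_b negbK /dvdn => /eqP g5; lia.
have is_b : in_b n -> [/\ u n %% 4 \in [:: 1; 3],
    u n %% 4 = 1 -> g n %% 10 = 1 & u n %% 4 = 3 -> g n %% 10 = 9].
  case/in_bP=> m odd_m def_n; have := odd_u_rebase m; have := g_rebase m.
  rewrite odd_m -def_n -[odd (u n)](@odd_mod _ 4) //.
  have: u n %% 4 < 4 by rewrite ltn_mod.
  by case: (u n %% 4) => [|[|[|[|]]]] //= _ g5 _; split=> // _; lia.
split.
- have [/is_b[u4 g1 g9] | /not_b-> //] := boolP (in_b n).
  by move: u4; rewrite !inE => /orP[/eqP/g1-> | /eqP/g9->].
- by move=> no_k; apply: not_b; apply/negP => /in_b_enumerated.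
- by move=> /in_b_enumerated/is_b.
Qed.
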